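(* Let $\alpha\in(0,1]$ and $\beta=\sqrt{1-\alpha^2}$. Assume that $f$ is a weak solution to $$\alpha f''+\alpha|f'|^2 f+\beta (f\times f')'-\frac{x f'}{2}=0\quad\text{on }\mathbb{R}.$$ Then $f$ belongs to $C^\infty(\mathbb{R};\mathbb{S}^2)$ and there exists $c\ge 0$ such that $|f'(x)|=c\,e^{\alpha x^2/4}$ for all $x\in\mathbb{R}$.
   Context: $\mathbb{S}^2$ is the unit sphere in $\mathbb{R}^3$ and $\times$ is the cross product in $\mathbb{R}^3$. A weak solution to the equation is a function $f=(f_1,f_2,f_3)\in H^1_{\mathrm{loc}}(\mathbb{R};\mathbb{S}^2)$ (i.e. an $H^1_{\mathrm{loc}}$ function with values in $\mathbb{R}^3$ satisfying $|f|=1$; it is identified with its continuous representative) such that $$\int_{\mathbb{R}}\Big(-\alpha f'\cdot\varphi'+\alpha|f'|^2 f\cdot\varphi-\beta(f\times f')\cdot\varphi'-\frac{x}{2}f'\cdot\varphi\Big)\,dx=0$$ for all $\varphi=(\varphi_1,\varphi_2,\varphi_3)\in C_0^\infty(\mathbb{R};\mathbb{R}^3)$ (smooth, compactly supported). *)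

(* Defs.v *)
From mathcomp Require Import all_boot all_order all_algebra.
From mathcomp Require Import all_classical all_reals all_analysis.

Set Implicit Arguments.
Unset Strict Implicit.
Unset Printing Implicit Defensive.

Import Order.TTheory GRing.Theory Num.Theory.
Import numFieldNormedType.Exports.

Local Open Scope ring_scope.
Local Open Scope classical_set_scope.

(* The library norm `|u| on 'rV[R]_n is the sup norm, so the Euclidean
   structure of R^3 is introduced separately.  Limits and derivatives of
   functions R -> 'rV[R]_3 do not depend on this choice. *)
Definition dotp (R : realType) (n : nat) (u v : 'rV[R]_n) : R :=
  \sum_(i < n) u 0 i * v 0 i.

Definition enorm (R : realType) (n : nat) (u : 'rV[R]_n) : R :=
  Num.sqrt (dotp u u).

Definition sphere2 (R : realType) : set 'rV[R]_3 := [set u | enorm u = 1].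

Definition crossp (R : realType) (u v : 'rV[R]_3) : 'rV[R]_3 :=
  let c (w : 'rV[R]_3) (k : nat) : R := w 0 (inord k) in
  \row_(i < 3)
    [:: c u 1%N * c v 2%N - c u 2%N * c v 1%N;
        c u 2%N * c v 0%N - c u 0%N * c v 2%N;
        c u 0%N * c v 1%N - c u 1%N * c v 0%N]`_i.

Definition smooth (R : realType) (V : normedModType R) (u : R -> V) : Prop :=
  forall (k : nat) (x : R), derivable (u^`(k)) x 1.

Definition test_function (R : realType) (V : normedModType R) (phi : R -> V) :
    Prop :=
  smooth phi /\ compact (closure [set x | phi x != 0]).

Definition L1loc (R : realType) (n : nat) (u : R -> 'rV[R]_n) : Prop :=
  forall i : 'I_n, locally_integrable [set: R] (fun x => u x 0 i).

Definition L2loc (R : realType) (n : nat) (u : R -> 'rV[R]_n) : Prop :=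
  forall i : 'I_n, measurable_fun [set: R] (fun x => u x 0 i) /\
    locally_integrable [set: R] (fun x => u x 0 i ^+ 2).

Definition weak_derivative (R : realType) (n : nat) (u du : R -> 'rV[R]_n) :
    Prop :=
  L1loc du /\
  forall (i : 'I_n) (phi : R -> R), test_function phi ->
    \int[lebesgue_measure]_(x in [set: R]) (u x 0 i * derive1 phi x) =
    - \int[lebesgue_measure]_(x in [set: R]) (du x 0 i * phi x).

Definition H1loc (R : realType) (n : nat) (u : R -> 'rV[R]_n) : Prop :=
  L2loc u /\ exists du, weak_derivative u du /\ L2loc du.

(* f is the continuous representative of its H^1_loc class, so continuity is
   required and |f| = 1 holds everywhere.  The weak derivative is unique only
   up to null sets; the integral identity does not depend on its choice. *)
Definition weak_solution (R : realType) (alpha beta : R) (f : R -> 'rV[R]_3) :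
    Prop :=
  [/\ continuous f,
      forall x, sphere2 (f x),
      H1loc f &
      forall df : R -> 'rV[R]_3, weak_derivative f df ->
      forall phi : R -> 'rV[R]_3, test_function phi ->
        \int[lebesgue_measure]_(x in [set: R])
          (- alpha * dotp (df x) (derive1 phi x)
           + alpha * enorm (df x) ^+ 2 * dotp (f x) (phi x)
           - beta * dotp (crossp (f x) (df x)) (derive1 phi x)
           - x / 2 * dotp (df x) (phi x)) = 0].

(* Main.v *)
(* Put G = alpha f' + beta (f x f').  The equation says that G has the locally
   integrable weak derivative H = (x/2) f' - alpha |f'|^2 f.  Testing with
   smoothed indicators of [a, b] and using Lebesgue points, G agrees a.e. with a
   continuous w such that w(b) - w(a) is the integral of H over [a, b], and
   likewise f is a primitive of f'.  As |f| = 1 and alpha^2 + beta^2 = 1, f' is a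
   polynomial in f and G, so that (f, w) solves a first-order system with
   polynomial right-hand side; hence f and w are C^1, and then smooth.  Finally
   f . f' = 0 forces f . w = 0, whence |f'| = |w| and
   (|w|^2)' = 2 w . H = alpha x |w|^2. *)

Require Import Defs.
From mathcomp Require Import all_boot all_order all_algebra.
From mathcomp Require Import all_classical all_reals all_analysis.
From mathcomp Require Import measurable_realfun.
From mathcomp Require Import ring lra.
Import Order.TTheory GRing.Theory Num.Theory.
Import numFieldNormedType.Exports.
Local Open Scope ring_scope.
Local Open Scope classical_set_scope.

Set Implicit Arguments.
Unset Strict Implicit.
Unset Printing Implicit Defensive.

(** * Smooth functions *)

Section smooth_calculus.
Context {R : realType}.
Implicit Types (u v : R -> R) (S : set (R -> R)).

Lemma derive1nSr (V : normedModType R) (u : R -> V) k :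
  u^`(k.+1) = (derive1 u)^`(k).
Proof. by rewrite /derive1n iterSr. Qed.

Lemma is_derive_smooth u (x : R) : smooth u -> is_derive x 1 u (derive1 u x).
Proof. by move=> su; rewrite derive1E; apply/derivableP; exact: (su 0%N). Qed.

Lemma smooth_derive1 (V : normedModType R) (u : R -> V) :
  smooth u -> smooth (derive1 u).
Proof. by move=> su k x; rewrite -derive1nSr; exact: su. Qed.

Lemma smooth_continuous u : smooth u -> continuous u.
Proof.
by move=> su x; apply/differentiable_continuous/derivable1_diffP/(su 0%N).
Qed.

(** An inductive predicate, because induction on the order of differentiation does not pass directly
    through products. Once the derivatives of the generators lie in the algebra, so do all iterated
    derivatives, and no Leibniz formula is needed. *)
Inductive smooth_alg S : (R -> R) -> Prop :=
| smooth_alg_gen u : S u -> smooth_alg S u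
| smooth_alg_cst c : smooth_alg S (fun=> c)
| smooth_alg_add u v :
    smooth_alg S u -> smooth_alg S v -> smooth_alg S (fun x => u x + v x)
| smooth_alg_mul u v :
    smooth_alg S u -> smooth_alg S v -> smooth_alg S (fun x => u x * v x)
| smooth_alg_inv u :
    smooth_alg S u -> (forall x, u x != 0) -> smooth_alg S (fun x => (u x)^-1).

(* The derivatives of the generators only have to lie in the algebra: this is
   the bootstrap for solutions of polynomial differential systems. *)
Lemma smooth_algP S :
  (forall u, S u -> exists2 v, smooth_alg S v & forall x : R, is_derive x 1 u (v x)) ->
  forall u, smooth_alg S u -> smooth u.
Proof.
move=> dS.
have alg_derive u : smooth_alg S u ->
    exists2 v, smooth_alg S v & forall x : R, is_derive x 1 u (v x).
  elim=> {u} [u /dS//|c|u v Su [du Sdu udu] Sv [dv Sdv vdv]|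
    u v Su [du Sdu udu] Sv [dv Sdv vdv]|u Su [du Sdu udu] u0].
  - exists (fun=> 0); [exact: smooth_alg_cst|by move=> x; exact: is_derive_cst].
  - exists (fun x => du x + dv x); first exact: smooth_alg_add.
    by move=> x; exact: is_deriveD.
  - exists (fun x => u x * dv x + v x * du x).
      by apply: smooth_alg_add; exact: smooth_alg_mul.
    by move=> x; exact: is_deriveM.
  - exists (fun x => (-1 * ((u x)^-1 * (u x)^-1)) * du x).
      apply: smooth_alg_mul => //; apply: smooth_alg_mul.
        exact: smooth_alg_cst.
      by apply: smooth_alg_mul; exact: smooth_alg_inv.
    move=> x; apply: (is_derive_eq (is_deriveV (u0 x) (udu x))).
    by rewrite /GRing.scale/= mulN1r -invfM -expr2.
have alg_derive1 u : smooth_alg S u ->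
    (forall x : R, derivable u x 1) /\ smooth_alg S (derive1 u).
  move=> /alg_derive[v Sv uv]; split=> [x|]; first by have [] := uv x.
  suff -> : derive1 u = v by [].
  by apply/funext => x; rewrite derive1E; have [] := uv x.
move=> u Su k x; suff: smooth_alg S (u^`(k)) by move/alg_derive1 => [].
by elim: k => [//|k IH]; rewrite derive1nS; exact: (alg_derive1 _ IH).2.
Qed.

(** With all smooth functions as generators, derivatives of generators are again generators. This
    gives smoothness of sums, products and inverses at once. *)
Lemma smooth_alg_smooth u : smooth_alg (@smooth R R) u -> smooth u.
Proof.
apply: smooth_algP => {}u su; exists (derive1 u).
  by apply: smooth_alg_gen; exact: smooth_derive1.
by move=> x; exact: is_derive_smooth.
Qed.

Lemma is_derive_affine (c d x : R) : is_derive x 1 (fun y => c * y + d) c.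
Proof.
have -> : (fun y => c * y + d) = c *: (id : R -> R) + cst d by [].
by apply: is_derive_eq; rewrite addr0 /GRing.scale/= mulr1.
Qed.

(** The generators are all smooth functions composed with this one affine map: by the chain rule the
    derivative of a generator is a generator times the constant [c]. *)
Lemma smooth_affine (c d : R) u : smooth u -> smooth (fun x => u (c * x + d)).
Proof.
move=> su; apply: (@smooth_algP
  [set v | exists2 w : R -> R, smooth w & v = fun x : R => w (c * x + d)]); last first.
  by apply: smooth_alg_gen; exists u.
move=> _ [w sw ->]; exists (fun x => derive1 w (c * x + d) * c).
  apply: smooth_alg_mul; last exact: smooth_alg_cst.
  by apply: smooth_alg_gen; exists (derive1 w); first exact: smooth_derive1.
move=> x; apply: (@realfun.is_derive1_comp _ w (fun x => c * x + d)).
  exact: is_derive_smooth.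
exact: is_derive_affine.
Qed.

(** Iterated derivatives are computed coordinate by coordinate; the explicit formula [E] carries the
    induction. *)
Lemma smooth_mx (n : nat) (u : R -> 'rV[R]_n) :
  (forall i, smooth (fun x => u x 0 i)) -> smooth u.
Proof.
move=> su.
have E k : u^`(k) = fun x => \row_i (fun x => u x 0 i)^`(k) x.
  elim: k => [|k IH].
    by apply/funext => x; apply/rowP => i; rewrite !mxE.
  rewrite derive1nS IH; apply/funext => x; rewrite derive1E derive_mx.
    by apply/rowP => i; rewrite !mxE derive1nS derive1E; congr ('D_1 _ x);
       apply/funext => y; rewrite mxE.
  apply/derivable_mxP => i j.
  by under eq_fun do rewrite mxE; exact: su.
move=> k x; rewrite E; apply/derivable_mxP => i j.
by under eq_fun do rewrite mxE; exact: su.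
Qed.

End smooth_calculus.

(** * A smooth step function built from e^(-1/x) *)

Section smooth_step.
Context {R : realType}.

(** The case [n = 0] is the classical flat function. The powers of 1/x are included so that the
    derivative of a member of the family is a combination of members. *)
Definition flat (n : nat) (x : R) : R :=
  if 0 < x then x^-1 ^+ n * expR (- x^-1) else 0.

Lemma flat_ge0 n x : 0 <= flat n x.
Proof.
rewrite /flat; case: ifP => // x0.
by rewrite mulr_ge0 ?expR_ge0// exprn_ge0// invr_ge0 ltW.
Qed.

Lemma flat_le n x : flat n x <= n.+1`!%:R * `|x|.
Proof.
rewrite /flat; case: ifPn => [x0|_]; last by rewrite mulr_ge0.
have y0 : 0 < x^-1 by rewrite invr_gt0.
have := @expR_ge1Dxn R x^-1 n (ltW y0).
rewrite expRN gtr0_norm// ler_pdivrMr ?expR_gt0//.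
rewrite -[X in _ * X * _]invrK mulrAC ler_pdivlMr// -exprSr -ler_pdivrMl//.
by apply: le_trans; rewrite mulrC lerDr.
Qed.

(** Away from 0 this is calculus on one branch. At 0 the difference quotient of [flat n] at [h] is
    [flat n.+1 h], which tends to 0 by [flat_le]. *)
Lemma is_derive_flat n (x : R) :
  is_derive x 1 (flat n) (flat n.+2 x - n%:R * flat n.+1 x).
Proof.
have [x0|x0|->] := ltgtP x 0.
- apply: (@near_eq_is_derive _ _ _ (cst 0)); rewrite ?oner_eq0//.
    near=> y; rewrite /flat ltNge ltW//.
    by near: y; exact: lt_nbhsl.
  by rewrite /flat ltNge ltW//= mulr0 subr0; exact: is_derive_cst.
- have /near_eq_is_derive : \near x, x^-1 ^+ n * expR (- x^-1) = flat n x.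
    near=> y; rewrite /flat ifT//.
    by near: y; exact: lt_nbhsr.
  apply.
  have dV : is_derive x 1 (fun y : R => y^-1) (- x^-2).
    apply: (is_derive_eq (@is_deriveV _ id x 1 1 _ _)).
      by rewrite gt_eqF.
    by rewrite /GRing.scale/= mulr1.
  have dX := is_deriveX n dV.
  have dN : is_derive x 1 (fun y : R => - y^-1) (x^-2).
    by apply: (is_derive_eq (is_deriveN dV)); rewrite opprK.
  have dE := @realfun.is_derive1_comp _ expR (fun y : R => - y^-1) x _ _
    (is_derive_expR _) dN.
  have := is_deriveM dX dE.
  have -> : (fun y : R => y^-1) ^+ n * (expR \o (fun y : R => - y^-1)) =
            (fun y => y^-1 ^+ n * expR (- y^-1)).
    by apply/funext => y; rewrite /GRing.mul/= fctE.
  move=> /is_derive_eq; apply.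
  rewrite /flat x0 /GRing.scale/= fctE.
  case: n {dX} => [|n]; rewrite ?fctE !exprS ?mul0r; field; exact: lt0r_neq0.
- rewrite /flat ltxx mulr0 subr0.
  have cvg0 : (fun h : R => h^-1 *: ((flat n \o shift 0) (h *: 1) - flat n 0))
      @ 0^' --> (0 : R).
    apply/cvgr0Pnorm_le => e e0.
    near=> h.
    have h0 : h != 0 by near: h; exact: nbhs_dnbhs_neq.
    rewrite /= addr0 {2}/flat ltxx subr0 /GRing.scale/= mulr1.
    have -> : h^-1 * flat n h = flat n.+1 h.
      by rewrite /flat; case: ifP => _; rewrite ?mulr0// exprS mulrA.
    rewrite ger0_norm ?flat_ge0//.
    apply: (le_trans (flat_le _ _)).
    rewrite -ler_pdivlMl; last by rewrite ltr0n fact_gt0.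
    near: h; apply: dnbhs0_le.
    by rewrite mulr_gt0// invr_gt0 ltr0n fact_gt0.
  by apply: DeriveDef; [apply/cvg_ex; exists 0|exact/cvg_lim].
Unshelve. all: by end_near. Qed.

Lemma smooth_flat : smooth (flat 0).
Proof.
apply: (@smooth_algP R [set v | exists n, v = flat n]); last first.
  by apply: smooth_alg_gen; exists 0%N.
move=> _ [n ->]; exists (fun x => flat n.+2 x + (- n%:R) * flat n.+1 x).
  apply: smooth_alg_add; first by apply: smooth_alg_gen; exists n.+2.
  apply: smooth_alg_mul; first exact: smooth_alg_cst.
  by apply: smooth_alg_gen; exists n.+1.
by move=> x; rewrite mulNr; exact: is_derive_flat.
Qed.

(** The step is F(x) / (F(x) + F(1 - x)) with F = [flat 0]. The denominator is positive since x and
    1 - x are never both nonpositive. *)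
Lemma smooth_step_exists : exists s : R -> R,
  [/\ smooth s, forall x, 0 <= s x <= 1, forall x : R, x <= 0 -> s x = 0
    & forall x : R, 1 <= x -> s x = 1].
Proof.
have flat_gt0 x : 0 < x -> 0 < flat 0 x.
  by move=> x0; rewrite /flat x0 mulr_gt0 ?expR_gt0// exprn_gt0 ?invr_gt0.
have flat_eq0 x : x <= 0 -> flat 0 x = 0 by rewrite /flat ltNge => ->.
have den_gt0 x : 0 < flat 0 x + flat 0 (-1 * x + 1).
  have [x0|x0] := ltP 0 x.
    by rewrite ltr_wpDr ?flat_ge0// flat_gt0.
  by rewrite ltr_wpDl ?flat_ge0// flat_gt0//; lra.
exists (fun x => flat 0 x * (flat 0 x + flat 0 (-1 * x + 1))^-1); split.
- apply: smooth_alg_smooth; apply: smooth_alg_mul.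
    by apply: smooth_alg_gen; exact: smooth_flat.
  apply: smooth_alg_inv => [|x]; last by rewrite gt_eqF.
  apply: smooth_alg_add; apply: smooth_alg_gen; first exact: smooth_flat.
  exact: smooth_affine smooth_flat.
- move=> x; rewrite divr_ge0 ?flat_ge0//=; last exact: ltW.
  by rewrite ler_pdivrMr// mul1r lerDl flat_ge0.
- by move=> x x0; rewrite flat_eq0// mul0r.
- move=> x x1; rewrite (flat_eq0 (_ + _)); last by lra.
  by rewrite addr0 divff// gt_eqF// flat_gt0//; lra.
Qed.

End smooth_step.

(** * The lemma of du Bois-Reymond *)

Section locally_integrable_facts.
Context {R : realType}.
Notation mu := (@lebesgue_measure R).
Implicit Types (g h u : R -> R).

Lemma locally_integrable_itv g (a b : R) :
  locally_integrable setT g -> mu.-integrable `[a, b] (EFin \o g).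
Proof.
move=> [mg _ ig]; apply/integrableP; split.
  by apply/measurable_EFinP; exact: measurable_funTS.
by apply: ig => //; exact: segment_compact.
Qed.

Lemma continuous_itv_bounded u (a b : R) : continuous u ->
  exists2 M, 0 < M & forall x, x \in `[a, b]%R -> `|u x| <= M.
Proof.
move=> cu; have [ba|ab] := ltP b a.
  exists 1 => // x; rewrite in_itv/= => /andP[ax xb].
  by move: (le_lt_trans (le_trans ax xb) ba); rewrite ltxx.
have [|c _ uc] := @EVT_max R (fun x => `|u x|) a b ab.
  apply: continuous_subspaceT => x.
  by apply: continuous_comp; [exact: cu|exact: norm_continuous].
exists (`|u c| + 1); first by rewrite ltr_wpDl.
by move=> x /uc /le_trans; apply; rewrite lerDl.
Qed.

(** A compact set lies in some segment [[- b, b]], on which [u] is bounded. *)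
Lemma locally_integrableM u g : continuous u -> locally_integrable setT g ->
  locally_integrable setT (fun x => u x * g x).
Proof.
move=> cu lg; have [mg oT _] := lg; split => //.
  apply: measurable_funM => //; exact: continuous_measurable_fun.
move=> K _ cK.
have [M [_ KM]] := compact_bounded cK.
pose b := Num.max M 0 + 1.
have Kb x : K x -> x \in `[- b, b]%R.
  move=> Kx; rewrite in_itv/= -ler_norml.
  apply: (KM b) => //; rewrite /b ltr_pwDr// ?le_max ?lexx//.
have [N N0 uN] := continuous_itv_bounded (- b) b cu.
have iK : mu.-integrable K (EFin \o g).
  apply: (@integrableS _ _ _ mu [set` `[- b, b]%R]) => //.
    exact: compact_measurable.
  exact: locally_integrable_itv.
suff /integrableP[] : mu.-integrable K (EFin \o (fun x => u x * g x)) by [].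
have := @integrableMr _ _ _ mu K (compact_measurable cK) u (EFin \o g).
apply => //; first by apply: measurable_funTS; exact: continuous_measurable_fun.
exists N; split; first by rewrite num_real.
by move=> y Ny x Kx /=; apply: (le_trans (uN _ (Kb _ Kx))); exact: ltW.
Qed.

Lemma locally_integrableZ (k : R) g : locally_integrable setT g ->
  locally_integrable setT (fun x => k * g x).
Proof. by apply: locally_integrableM => x; exact: cvg_cst. Qed.

Lemma locally_integrable_cst (k : R) :
  locally_integrable setT (fun=> k : R).
Proof.
split => [||K _ cK]; [exact: measurable_cst|exact: openT|].
by rewrite integral_cst//= ?lte_mul_pinfty//;
  [exact: compact_finite_measure|exact: compact_measurable].
Qed.

Lemma integrable_supported g u (a b : R) : continuous u ->
  (forall x, x \notin `[a, b]%R -> u x = 0) -> locally_integrable setT g ->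
  mu.-integrable setT (EFin \o (fun x => g x * u x)).
Proof.
move=> cu u0 lg.
have -> : EFin \o (fun x => g x * u x) =
          (EFin \o (fun x => u x * g x)) \_ `[a, b].
  apply/funext => x; rewrite patchE /= mulrC; case: ifPn => // xab.
  by rewrite u0 ?mul0r//; apply: contraNN xab; rewrite inE.
apply/integrable_restrict => //; rewrite setTI.
by apply: locally_integrable_itv; exact: locally_integrableM.
Qed.

Lemma Rintegral_supported g (D : set R) : (forall x, ~ D x -> g x = 0) ->
  \int[mu]_x g x = \int[mu]_(x in D) g x.
Proof.
move=> g0; rewrite [RHS]Rintegral_mkcond; apply: eq_Rintegral => x _.
rewrite patchE; case: ifPn => // xD; apply: g0 => Dx.
by move/negP: xD; apply; rewrite inE.
Qed.

End locally_integrable_facts.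

(** * Smoothed indicators of intervals and Lebesgue points *)

Section mollification.
Context {R : realType}.
Notation mu := (@lebesgue_measure R).
Variable s : R -> R.
Hypothesis s_smooth : smooth s.
Hypothesis s_itv : forall x, 0 <= s x <= 1.
Hypothesis s0 : forall x : R, x <= 0 -> s x = 0.
Hypothesis s1 : forall x, 1 <= x -> s x = 1.

Lemma derive1_step_eq0 x : x \notin `[0, 1]%R -> derive1 s x = 0.
Proof.
rewrite in_itv/= negb_and -!ltNge => /orP[x0|x1]; rewrite derive1E.
  rewrite (@near_eq_derive _ _ _ s (cst 0)) ?derive_cst//.
  near=> y; rewrite s0//.
  by apply: ltW; near: y; exact: lt_nbhsl.
rewrite (@near_eq_derive _ _ _ s (cst 1)) ?derive_cst//.
near=> y; rewrite s1//.
by apply: ltW; near: y; exact: lt_nbhsr.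
Unshelve. all: by end_near. Qed.

(** The transition from 0 to 1 takes place on [[a, a + n.+1%:R^-1]], to the right of [a]. The
    derivative [kernel a n] is a one-sided approximate identity at [a]. The argument is written in
    the shape required by [smooth_affine]. *)
Let step (a : R) (n : nat) (x : R) := s (n.+1%:R * x + - (n.+1%:R * a)).
Let kernel (a : R) (n : nat) (x : R) :=
  derive1 s (n.+1%:R * x + - (n.+1%:R * a)) * n.+1%:R.

Lemma step_smooth a n : smooth (step a n).
Proof. exact: smooth_affine. Qed.

Lemma is_derive_step a n (x : R) : is_derive x 1 (step a n) (kernel a n x).
Proof.
apply: (@realfun.is_derive1_comp _ s (fun x => n.+1%:R * x + - (n.+1%:R * a))).
  exact: is_derive_smooth.
exact: is_derive_affine.
Qed.

Lemma kernel_continuous a n : continuous (kernel a n).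
Proof.
have -> : kernel a n = derive1 (step a n).
  by apply/funext => x; rewrite derive1E; have [] := is_derive_step a n x.
exact/smooth_continuous/smooth_derive1/step_smooth.
Qed.

Lemma kernel_eq0 a n x : x \notin `[a, a + n.+1%:R^-1]%R -> kernel a n x = 0.
Proof.
move=> xa; rewrite /kernel derive1_step_eq0 ?mul0r//.
apply: contra xa; rewrite !in_itv/= -mulrBr => /andP[y0 y1].
rewrite -subr_ge0 -(pmulr_rge0 _ (_ : 0 < n.+1%:R)) ?ltr0n// y0/=.
by rewrite -lerBlDl -[leRHS]mul1r ler_pdivlMr ?ltr0n// mulrC.
Qed.

Lemma Rintegral_kernel a n : \int[mu]_(x in `[a, a + n.+1%:R^-1]) kernel a n x = 1.
Proof.
have n0 : (0 : R) < n.+1%:R^-1 by rewrite invr_gt0.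
rewrite /Rintegral (@continuous_FTC2 _ _ (step a n)) ?ltrDl//.
- rewrite -EFinB/= /step subrr (@s0 0)// s1 ?subr0//.
  by rewrite mulrDr divff ?pnatr_eq0// addrAC subrr add0r.
- by apply: continuous_subspaceT; exact: kernel_continuous.
- have cs := smooth_continuous (@step_smooth a n).
  split.
  + by move=> x _; exact: (@step_smooth a n 0%N x).
  + by apply: cvg_at_right_filter; exact: cs.
  + by apply: cvg_at_left_filter; exact: cs.
- by move=> x _; rewrite derive1E; have [] := is_derive_step a n x.
Qed.

(** The kernel has integral 1, so the difference is the integral of [g - g a] against it. As [s] is
    not assumed monotone, the kernel is only bounded by M (n + 1) in absolute value. The ball of
    radius 2 / (n + 1) has measure 4 / (n + 1), whence the constant 4 M; the factor 2 in the radius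
    puts the closed support inside the open ball. *)
Lemma kernel_dist g a n M : (forall x, x \in `[0, 1]%R -> `|derive1 s x| <= M) ->
  locally_integrable setT g ->
  ((`|g a - \int[mu]_x (g x * kernel a n x)|)%:E <=
   (4 * M)%:E * davg g a (2 * n.+1%:R^-1))%E.
Proof.
move=> sM lg; set d : R := n.+1%:R^-1.
have d0 : 0 < d by rewrite invr_gt0.
have M0 : 0 <= M.
  by rewrite (le_trans _ (sM 0 _))// in_itv/= lexx ler01.
have kM x : `|kernel a n x| <= M * n.+1%:R.
  rewrite normrM (ger0_norm (ler0n _ _)) ler_wpM2r//.
  set y := _ + _; have [y01|/derive1_step_eq0->] := boolP (y \in `[0, 1]%R).
    exact: sM.
  by rewrite normr0.
have ck := @kernel_continuous a n.
pose I := [set` `[a, a + d]%R].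
have mI : measurable I by exact: measurable_itv.
pose ga x := g x - g a.
have lga : locally_integrable setT ga.
  by apply: locally_integrableB => //; exact: locally_integrable_cst.
have lM h : locally_integrable setT h ->
    mu.-integrable I (EFin \o (fun x => kernel a n x * h x)).
  by move=> lh; apply: locally_integrable_itv; exact: locally_integrableM.
have ik c : mu.-integrable I (EFin \o (fun x => c * kernel a n x)).
  rewrite (_ : (fun x => c * _) = fun x => kernel a n x * c).
    exact: lM (locally_integrable_cst _).
  by apply/funext => x; rewrite mulrC.
have intE : \int[mu]_x (g x * kernel a n x) =
    \int[mu]_(x in I) (kernel a n x * ga x) + g a.
  rewrite (@Rintegral_supported _ _ I); last first.
    move=> x Ix; rewrite kernel_eq0 ?mulr0//.
    by apply/negP => xI; apply: Ix.
  have <- : \int[mu]_(x in I) (g a * kernel a n x) = g a.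
    rewrite RintegralZl ?Rintegral_kernel ?mulr1//.
    rewrite (_ : kernel a n = fun x => 1 * kernel a n x); first exact: ik.
    by apply/funext => x; rewrite mul1r.
  rewrite -RintegralD//; last exact: lM.
  by apply: eq_Rintegral => x _; rewrite /ga; ring.
rewrite intE opprD addrCA subrr addr0 normrN.
have iabs : mu.-integrable I (EFin \o (fun x => `|ga x|)).
  by apply: integrable_norm; exact: locally_integrable_itv.
apply: (@le_trans _ _ ((M * n.+1%:R)%:E * \int[mu]_(x in I) `|ga x|%:E)%E).
  rewrite -(fineK (integrable_fin_num _ iabs))//= -EFinM lee_fin.
  apply: (le_trans (le_normr_Rintegral _ _)) => //; first exact: lM.
  rewrite -RintegralZl//; apply: le_Rintegral => //.
  - by apply: integrable_norm; exact: lM.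
  - exact: integrableZl iabs.
  - by move=> x _; rewrite normrM ler_wpM2r.
rewrite /davg /iavg lebesgue_measure_ball ?mulr_ge0 ?(ltW d0)//.
rewrite inver gt_eqF ?mulrn_wgt0 ?mulr_gt0// muleA -EFinM.
rewrite (_ : 4 * M * _ = M * n.+1%:R); last first.
  have : n.+1%:R != 0 :> R by rewrite pnatr_eq0.
  by rewrite /d -mulr_natr; set N := n.+1%:R => N0; field.
rewrite lee_wpmul2l ?lee_fin ?mulr_ge0//.
apply: ge0_subset_integral => //=.
- exact: measurable_ball.
- apply/measurable_EFinP; apply: measurableT_comp => //.
  by apply: measurable_funTS; case: lga.
- move=> x; rewrite /I/= in_itv/= => /andP[ax xad].
  rewrite /ball/= ler0_norm ?subr_le0// opprB.
  by rewrite ltrBlDl (le_lt_trans xad)// ltrD2l ltr_pMl// ltr1n.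
Qed.

(** At a Lebesgue point the mean deviation [davg g a t] tends to 0 with the radius, and
    [kernel_dist] bounds the error by a fixed multiple of it. *)
Lemma kernel_cvg g a : locally_integrable setT g -> lebesgue_pt g a ->
  \int[mu]_x (g x * kernel a n x) @[n --> \oo] --> g a.
Proof.
move=> lg ga.
have [M M0 sM] := continuous_itv_bounded 0 1
  (smooth_continuous (smooth_derive1 s_smooth)).
apply/cvgrPdist_le => e e0.
have /fine_cvgP[gfin /cvgr0Pnorm_le] := ga.
have e1 : 0 < e / (4 * M) by rewrite divr_gt0// mulr_gt0.
move=> /(_ _ e1) gle.
have [r r0 rP] : exists2 r : R, 0 < r & forall t, 0 < t -> t < r ->
    (davg g a t <= (e / (4 * M))%:E)%E.
  have : \forall t \near 0^'+, (davg g a t <= (e / (4 * M))%:E)%E.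
    near=> t.
    have tfin : davg g a t \is a fin_num by near: t.
    rewrite -(fineK tfin) lee_fin (le_trans (ler_norm _))//.
    by near: t.
  move=> [r r0 rP]; exists r => // t t0 tr; apply: rP => //=.
  by rewrite sub0r normrN gtr0_norm.
near=> n.
rewrite -lee_fin; apply: (le_trans (kernel_dist a n sM lg)).
have -> : e%:E = ((4 * M)%:E * (e / (4 * M))%:E)%E.
  by rewrite -EFinM mulrC divfK// gt_eqF// mulr_gt0.
rewrite lee_wpmul2l//; first by rewrite lee_fin mulr_ge0 ?ltW.
apply: rP; first by rewrite mulr_gt0 ?invr_gt0.
rewrite ltr_pdivrMr ?ltr0n// -ltr_pdivrMl// mulrC.
near: n; apply: filterS (nbhs_infty_gtr (2 / r)) => n /lt_trans; apply.
by rewrite ltr_nat.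
Unshelve. all: by end_near. Qed.

Lemma step_eq0 a n x : x <= a -> step a n x = 0.
Proof.
by move=> xa; rewrite /step s0// -mulrBr mulr_ge0_le0// subr_le0.
Qed.

Lemma step_eq1 a n x : a + n.+1%:R^-1 <= x -> step a n x = 1.
Proof.
move=> ax; rewrite /step s1// -mulrBr mulrC -ler_pdivrMr ?ltr0n// div1r.
by rewrite lerBrDl.
Qed.

Lemma step_near1 a x : a < x -> \forall n \near \oo, step a n x = 1.
Proof.
move=> ax; apply: filterS (nbhs_infty_gtr (x - a)^-1) => n xan.
rewrite step_eq1// -lerBrDl -[leRHS]invrK lef_pV2 ?posrE ?invr_gt0 ?subr_gt0//.
by rewrite (le_trans (ltW xan))// ler_nat.
Qed.

Lemma step_itv a n x : 0 <= step a n x <= 1.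
Proof. exact: s_itv. Qed.

(** The transition at [b] ends at b + 1 / (n + 1), so one segment contains the supports for every
    [n]. *)
Lemma stepB_eq0 a b n x : a < b -> x \notin `[a, b + 1]%R ->
  step a n x - step b n x = 0.
Proof.
move=> ab; rewrite in_itv/= negb_and -!ltNge => /orP[xa|bx].
  by rewrite !step_eq0 ?subrr// ltW// (lt_trans xa).
have n1 : n.+1%:R^-1 <= 1 :> R by rewrite invf_le1 ?ltr0n// ler1n.
rewrite !step_eq1 ?subrr//; move: n1; set d := _^-1 => d1; lra.
Qed.

(** Dominated convergence on [[a, b + 1]]: a difference of two numbers in [0, 1] has absolute value
    at most 1, so |h| dominates. *)
Lemma step_cvg h a b : a < b -> locally_integrable setT h ->
  \int[mu]_x (h x * (step a n x - step b n x)) @[n --> \oo] -->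
  \int[mu]_(x in `[a, b]) h x.
Proof.
move=> ab lh; pose D := [set` `[a, b + 1]%R].
have mD : measurable D by exact: measurable_itv.
pose h_ n x := h x * (step a n x - step b n x).
have ch n : continuous (fun x => step a n x - step b n x).
  by move=> x; apply: cvgB; apply: smooth_continuous; exact: step_smooth.
have lh_ n : locally_integrable setT (h_ n).
  rewrite /h_; under eq_fun do rewrite mulrC.
  exact: locally_integrableM.
(* The pointwise limit is the indicator of []a, b]]: both steps vanish at [a], while at [b] the
   first tends to 1 and the second is 0. *)
have -> : \int[mu]_(x in `[a, b]) h x = \int[mu]_(x in D) (h \_ `]a, b]) x.
  rewrite -Rintegral_mkcondr -Rintegral_itv_obnd_cbnd; last first.
    apply: (@integrableS _ _ _ mu [set` `[a, b]%R]) => //.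
      exact: subset_itv_oc_cc.
    exact: locally_integrable_itv.
  congr Rintegral; apply/seteqP; split => x; rewrite /D/= !in_itv/=.
    by move=> /andP[ax xb]; rewrite ax xb (ltW ax) (le_trans xb)// lerDl.
  by move=> [].
rewrite (_ : (fun n => _) = fun n => \int[mu]_(x in D) h_ n x); last first.
  apply/funext => n; apply: Rintegral_supported => x xD.
  by rewrite /h_ stepB_eq0 ?mulr0//; apply/negP.
have [|||||iD _] := @dominated_convergence _ _ _ mu D mD
  (fun n => EFin \o h_ n) (EFin \o (h \_ `]a, b])) (EFin \o (fun x => `|h x|)).
- by move=> n; apply/measurable_EFinP; apply: measurable_funTS; case: (lh_ n).
- apply/measurable_EFinP; apply: measurable_funTS.
  by apply/(measurable_restrictT _ _).1 => //; apply: measurable_funTS; case: lh.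
- apply: aeW => x _; apply: cvg_EFin; first exact: nearW.
  apply: cvg_near_cst.
  rewrite /= patchE; have [xa|ax] := leP x a.
    apply: nearW => n /=; rewrite /h_ !step_eq0 ?subrr ?mulr0 ?(le_trans xa (ltW ab))//.
    by rewrite memNset//= in_itv/= ltNge xa.
  have [bx|xb] := ltP b x.
    rewrite memNset; last by rewrite /= in_itv/= ax leNgt bx.
    near=> n; rewrite /= /h_; have -> : step a n x = 1 by near: n; exact: step_near1.
    have -> : step b n x = 1 by near: n; exact: step_near1.
    by rewrite subrr mulr0.
  rewrite mem_set; last by rewrite /= in_itv/= ax.
  near=> n; rewrite /= /h_; have -> : step a n x = 1 by near: n; exact: step_near1.
  by rewrite step_eq0// subr0 mulr1.
- by apply: integrable_norm; exact: locally_integrable_itv.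
- apply: aeW => x n _ /=; rewrite lee_fin normrM ler_piMr//.
  have := step_itv a n x; have := step_itv b n x.
  move=> /andP[? ?] /andP[? ?]; rewrite ler_norml; apply/andP; split; lra.
move=> dc; apply: fine_cvg; rewrite fineK//; exact: integrable_fin_num.
Unshelve. all: by end_near. Qed.

(** The test functions are the smoothed indicators [step a n - step b n]. The two sides of the weak
    identity tend to g(a) - g(b) and to minus the integral of [h]. *)
Lemma lebesgue_pt_increment g h a b : a < b ->
  locally_integrable setT g -> locally_integrable setT h ->
  (forall phi c d, smooth phi -> (forall x, x \notin `[c, d]%R -> phi x = 0) ->
    \int[mu]_x (g x * derive1 phi x) = - \int[mu]_x (h x * phi x)) ->
  lebesgue_pt g a -> lebesgue_pt g b -> g b - g a = \int[mu]_(x in `[a, b]) h x.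
Proof.
move=> ab lg lh gh ga gb.
pose phi n x := step a n x - step b n x.
have phi_smooth n : smooth (phi n).
  rewrite (_ : phi n = fun x => step a n x + -1 * step b n x).
    apply: smooth_alg_smooth; apply: smooth_alg_add.
      by apply: smooth_alg_gen; exact: step_smooth.
    apply: smooth_alg_mul; first exact: smooth_alg_cst.
    by apply: smooth_alg_gen; exact: step_smooth.
  by apply/funext => x; rewrite mulN1r.
have phi_eq0 n x : x \notin `[a, b + 1]%R -> phi n x = 0.
  exact: stepB_eq0.
have dphi n : derive1 (phi n) = fun x => kernel a n x - kernel b n x.
  apply/funext => x; rewrite derive1E.
  by have [] := is_deriveB (is_derive_step a n x) (is_derive_step b n x).
have lhs : \int[mu]_x (g x * derive1 (phi n) x) @[n --> \oo] --> g a - g b.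
  rewrite (_ : (fun n => _) = fun n => \int[mu]_x (g x * kernel a n x) -
      \int[mu]_x (g x * kernel b n x)).
    by apply: cvgB; exact: kernel_cvg.
  apply/funext => n; rewrite dphi -RintegralB//.
  - by apply: eq_Rintegral => x _; rewrite mulrBr.
  - apply: integrable_supported lg; first exact: kernel_continuous.
    by move=> x; exact: kernel_eq0.
  - apply: integrable_supported lg; first exact: kernel_continuous.
    by move=> x; exact: kernel_eq0.
have rhs : \int[mu]_x (g x * derive1 (phi n) x) @[n --> \oo] -->
    - \int[mu]_(x in `[a, b]) h x.
  rewrite (_ : (fun n => _) = fun n => - \int[mu]_x (h x * phi n x)).
    by apply: cvgN; exact: step_cvg.
  by apply/funext => n; rewrite (gh _ _ _ (phi_smooth n) (phi_eq0 n)).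
by rewrite -opprB (cvg_unique _ lhs rhs)// opprK.
Qed.

End mollification.

(** * From the weak identity to a continuous primitive *)

Section du_bois_reymond.
Context {R : realType}.
Notation mu := (@lebesgue_measure R).
Implicit Types g h w : R -> R.

Lemma Rintegral_itv_split h a b c : locally_integrable setT h ->
  a <= b -> b <= c ->
  \int[mu]_(x in `[a, c]) h x =
  \int[mu]_(x in `[a, b]) h x + \int[mu]_(x in `[b, c]) h x.
Proof.
move=> lh ab bc; apply/eqP; rewrite addrC -subr_eq; apply/eqP.
rewrite Rintegral_itvB//; last exact: locally_integrable_itv.
rewrite Rintegral_itv_obnd_cbnd//.
apply: (@integrableS _ _ _ mu [set` `[b, c]%R]) => //.
  exact: subset_itv_oc_cc.
exact: locally_integrable_itv.
Qed.

(** A ball has positive measure, so no null set contains it. *)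
Lemma ae_dense (P : R -> Prop) : {ae mu, forall x, P x} ->
  forall x e, 0 < e -> exists2 y, ball x e y & P y.
Proof.
move=> [N [mN N0 PN]] x e e0; apply: contrapT => nP.
have xN : ball x e `<=` N.
  by move=> y xy; apply: PN => Py; apply: nP; exists y.
have : (mu (ball x e) <= mu N)%E.
  by apply: le_measure => //; rewrite inE//; exact: measurable_ball.
rewrite N0 lebesgue_measure_ball ?(ltW e0)// lee_fin.
by rewrite leNgt mulrn_wgt0.
Qed.

Lemma continuous_ae_eq g h : continuous g -> continuous h ->
  {ae mu, forall x, g x = h x} -> g = h.
Proof.
move=> cg ch gh; apply/funext => x; apply: contrapT => gx.
have ck : {for x, continuous (fun y => g y - h y)}.
  by apply: cvgB; [exact: cg|exact: ch].
have k0 : 0 < `|g x - h x| by rewrite normr_gt0 subr_eq0; apply/eqP.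
have /cvgrPdist_lt/(_ _ k0)[e /= e0 xe] := ck.
have [y xy ghy] := ae_dense gh x e0.
by have := xe y xy; rewrite ghy subrr subr0 ltxx.
Qed.

(** Almost every point is a Lebesgue point of [g]. Integrating [h] from one such point [c], with
    initial value [g c], gives [w]; the increment formula shows that [w] equals [g] at every other
    Lebesgue point. *)
Lemma du_bois_reymond g h :
  locally_integrable setT g -> locally_integrable setT h ->
  (forall phi c d, smooth phi -> (forall x, x \notin `[c, d]%R -> phi x = 0) ->
    \int[mu]_x (g x * derive1 phi x) = - \int[mu]_x (h x * phi x)) ->
  exists w, [/\ continuous w, {ae mu, forall x, g x = w x} &
    forall a b, a <= b -> w b - w a = \int[mu]_(x in `[a, b]) h x].
Proof.
move=> lg lh gh.
have [s [ss s01 s0 s1]] := @smooth_step_exists R.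
have inc a b : a < b -> lebesgue_pt g a -> lebesgue_pt g b ->
    g b - g a = \int[mu]_(x in `[a, b]) h x.
  by move=> ab; exact: (@lebesgue_pt_increment R s).
have lpt := lebesgue_differentiation lg.
have [c _ gc] := ae_dense lpt 0 ltr01.
(* Integrals over segments are unoriented, so the two sides of [c] are treated separately. *)
pose w x := if c <= x then g c + \int[mu]_(t in `[c, x]) h t
                      else g c - \int[mu]_(t in `[x, c]) h t.
have wB a b : a <= b -> w b - w a = \int[mu]_(x in `[a, b]) h x.
  move=> ab; rewrite /w; case: (leP c a) => oa.
    by rewrite (le_trans oa ab) (@Rintegral_itv_split h c a b)//; ring.
  case: (leP c b) => ob.
    by rewrite (@Rintegral_itv_split h a c b) ?(ltW oa)//; ring.
  by rewrite (@Rintegral_itv_split h a b c) ?(ltW ob)//; ring.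
have cw : continuous w.
  move=> x.
  have x11 : x - 1 < x + 1 by lra.
  (* Restarting the integral at [x - 1] gives a single formula for [w] near [x], on whichever side
     of [c] it lies. *)
  have cI : {for x, continuous
      (fun y => w (x - 1) + \int[mu]_(t in `[x - 1, y]) h t)}.
    apply: cvgD; first exact: cvg_cst.
    apply: (within_continuous_continuous x11); last by rewrite in_itv/=; lra.
    apply: parameterized_integral_continuous; first exact: ltW.
    exact: locally_integrable_itv.
  have wE y : x - 1 <= y -> w (x - 1) + \int[mu]_(t in `[x - 1, y]) h t = w y.
    by move=> /wB <-; rewrite addrC subrK.
  move: cI; rewrite /prop_for /continuous_at wE; last lra.
  apply: cvg_trans; apply: near_eq_cvg; near=> y.
  rewrite wE// ltW//; near: y; apply: lt_nbhsr; lra.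
exists w; split => //.
move: lpt; apply: filter_app; first exact: (ae_filter_ringOfSetsType mu).
apply: aeW => x gx.
have [xo|ox|->] := ltgtP x c; rewrite /w.
- by rewrite leNgt xo/= -inc//; ring.
- by rewrite (ltW ox) -inc//; ring.
- by rewrite lexx set_itv1 Rintegral_set1 addr0.
Unshelve. all: by end_near. Qed.

End du_bois_reymond.

(** * The first-order system *)

Section vector_algebra.
Context {R : realType}.
Implicit Types (u v w : 'rV[R]_3) (al be : R).

Lemma ord3P (P : 'I_3 -> Prop) :
  P (inord 0) -> P (inord 1) -> P (inord 2) -> forall i, P i.
Proof.
move=> P0 P1 P2 i; rewrite -(inord_val i).
by case: (val i) (ltn_ord i) => [|[|[|]]].
Qed.

Lemma dotp3 u v : dotp u v = u 0 (inord 0) * v 0 (inord 0) +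
  u 0 (inord 1) * v 0 (inord 1) + u 0 (inord 2) * v 0 (inord 2).
Proof.
rewrite /dotp !big_ord_recl big_ord0 addr0 addrA.
by congr (_ * _ + _ * _ + _ * _); congr (_ _ _); apply/val_inj; rewrite /= inordK.
Qed.

(** The type product makes the three equations one multi-rule for [rewrite]; vector identities then
    reduce to polynomial ones in the coordinates. *)
Lemma crossp3 u v :
  (crossp u v 0 (inord 0) =
     u 0 (inord 1) * v 0 (inord 2) - u 0 (inord 2) * v 0 (inord 1)) *
  (crossp u v 0 (inord 1) =
     u 0 (inord 2) * v 0 (inord 0) - u 0 (inord 0) * v 0 (inord 2)) *
  (crossp u v 0 (inord 2) =
     u 0 (inord 0) * v 0 (inord 1) - u 0 (inord 1) * v 0 (inord 0)).
Proof. by do !split; rewrite /crossp mxE inordK. Qed.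

Lemma dotp_ge0 u : 0 <= dotp u u.
Proof. by apply: sumr_ge0 => i _; rewrite -expr2 sqr_ge0. Qed.

Lemma enorm_sqr u : enorm u ^+ 2 = dotp u u.
Proof. by rewrite sqr_sqrtr// dotp_ge0. Qed.

Lemma sphere2_dotp u : sphere2 u -> dotp u u = 1.
Proof. by rewrite /sphere2/= -enorm_sqr => ->; rewrite expr1n. Qed.

Lemma dotp_delta u a i : dotp u (a *: delta_mx 0 i) = u 0 i * a.
Proof.
rewrite /dotp (bigD1 i)//= big1 ?addr0 => [|j ji]; rewrite !mxE ?eqxx ?mulr1//.
by rewrite (negPf ji) !mulr0.
Qed.

(* The inverse of [v |-> al *: v + be *: crossp u v] for a unit vector [u]. *)
Definition velocity al be u w : 'rV[R]_3 :=
  al *: w - be *: crossp u w + (be ^+ 2 / al * dotp u w) *: u.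

Variables (al be : R).
Hypothesis al0 : al != 0.
Hypothesis albe : al ^+ 2 + be ^+ 2 = 1.

Lemma velocityK u v : dotp u u = 1 ->
  velocity al be u (al *: v + be *: crossp u v) = v.
Proof.
move=> u1; apply/rowP; rewrite dotp3 in u1.
(* The factor 1 is kept so that [-u1] turns it into |u|^2. The goal becomes a rational identity that
   no longer depends on the constraints on [u], [al] and [be], apart from [al] being nonzero. *)
have E (x : R) : (al ^+ 2 + be ^+ 2 * 1) * x = x by rewrite mulr1 albe mul1r.
by apply: ord3P; rewrite -[RHS]E -u1 /velocity dotp3 !(crossp3, mxE); field.
Qed.

Lemma dotp_velocity u w : dotp u u = 1 ->
  dotp u (velocity al be u w) = dotp u w / al.
Proof.
move=> u1.
have -> : dotp u w / al = (al ^+ 2 + be ^+ 2 * dotp u u) * (dotp u w / al).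
  by rewrite u1 mulr1 albe mul1r.
by rewrite /velocity !dotp3 !(crossp3, mxE); field.
Qed.

(** The vector [w] is orthogonal to [crossp u w], and Lagrange's identity |u x w|^2 = |u|^2 |w|^2 -
    (u . w)^2 makes the two squared terms add up to |w|^2. *)
Lemma velocity_orthogonal u w : dotp u u = 1 -> dotp u w = 0 ->
  dotp w (velocity al be u w) = al * dotp w w /\
  dotp (velocity al be u w) (velocity al be u w) = dotp w w.
Proof.
move=> u1 uw.
have -> : velocity al be u w = al *: w - be *: crossp u w.
  by rewrite /velocity uw mulr0 scale0r addr0.
split; first by rewrite !dotp3 !(crossp3, mxE); ring.
have -> : dotp w w = al ^+ 2 * dotp w w +
    be ^+ 2 * (dotp u u * dotp w w - dotp u w ^+ 2).
  by rewrite u1 uw expr0n subr0 mul1r -mulrDl albe mul1r.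
by rewrite !dotp3 !(crossp3, mxE); ring.
Qed.

End vector_algebra.

(** * Continuity in the algebra, primitives, and vector test functions *)

Section test_functions_and_primitives.
Context {R : realType}.
Notation mu := (@lebesgue_measure R).

(** This yields continuity of the right-hand sides of the system while [f] and [w] are only known to
    be continuous. *)
Lemma smooth_alg_continuous (S : set (R -> R)) :
  (forall u, S u -> continuous u) -> forall u, smooth_alg S u -> continuous u.
Proof.
move=> cS u; elim=> {u} [u /cS//|c|u v _ cu _ cv|u v _ cu _ cv|u _ cu u0] x.
- exact: cvg_cst.
- by apply: cvgD; [exact: cu|exact: cv].
- by apply: cvgM; [exact: cu|exact: cv].
- by apply: cvgV => //; exact: cu.
Qed.

(** The integrand [h] may be replaced by [k] under the integral, and the fundamental theorem of
    calculus applies to the continuous [k]. Starting at [x - 1] makes [x] an interior point. *)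
Lemma is_derive_primitive (w h k : R -> R) :
  (forall a b, a <= b -> w b - w a = \int[mu]_(x in `[a, b]) h x) ->
  measurable_fun setT h -> continuous k -> {ae mu, forall x, h x = k x} ->
  forall x : R, is_derive x 1 w (k x).
Proof.
move=> wB mh ck hk x.
pose F y := w (x - 1) + \int[mu]_(t in `[x - 1, y]) k t.
have FE y : x - 1 <= y -> F y = w y.
  move=> xy; rewrite /F -[RHS](subrK (w (x - 1))) addrC wB//; congr (_ + _).
  rewrite /Rintegral; congr fine; apply: ae_eq_integral => //.
  - by apply/measurable_EFinP; apply: measurable_funTS; exact: continuous_measurable_fun.
  - by apply/measurable_EFinP; exact: measurable_funTS.
  - move: hk; apply: filter_app; first exact: (ae_filter_ringOfSetsType mu).
    by apply: aeW => z hkz _ /=; rewrite hkz.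
apply: (@near_eq_is_derive _ _ _ F).
  near=> y; apply: FE; apply: ltW.
  by near: y; apply: lt_nbhsr; rewrite ltrBlDr ltrDl.
have [dF F'] : derivable (fun y => \int[mu]_(t in `[x - 1, y]) k t) x 1 /\
    derive1 (fun y => \int[mu]_(t in `[x - 1, y]) k t) x = k x.
  apply: (@continuous_FTC1_closed _ k (x - 1) x (x + 1)); rewrite ?ltrDl//.
  - apply: locally_integrable_itv; rewrite (_ : k = fun x => k x * 1).
      by apply: locally_integrableM => //; exact: locally_integrable_cst.
    by apply/funext => y; rewrite mulr1.
  - by rewrite ltrBlDr ltrDl.
  - exact: ck.
have dF' : is_derive x 1 (fun y => \int[mu]_(t in `[x - 1, y]) k t) (k x).
  by apply: DeriveDef; [exact: dF|rewrite -derive1E].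
have := is_deriveD (is_derive_cst (w (x - 1)) x 1) dF'.
by rewrite add0r.
Unshelve. all: by end_near. Qed.

Lemma derive1_supported (V : normedModType R) (u : R -> V) (a b : R) :
  (forall x, x \notin `[a, b]%R -> u x = 0) ->
  forall x, x \notin `[a, b]%R -> derive1 u x = 0.
Proof.
move=> u0 x; rewrite in_itv/= negb_and -!ltNge => /orP[xa|bx]; rewrite derive1E.
  rewrite (@near_eq_derive _ _ _ u (cst 0)) ?derive_cst//.
  near=> y; apply: u0; rewrite in_itv/= negb_and -ltNge; apply/orP; left.
  by near: y; exact: lt_nbhsl.
rewrite (@near_eq_derive _ _ _ u (cst 0)) ?derive_cst//.
near=> y; apply: u0; rewrite in_itv/= negb_and -!ltNge; apply/orP; right.
by near: y; exact: lt_nbhsr.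
Unshelve. all: by end_near. Qed.

Lemma supported_compact (V : normedModType R) (u : R -> V) (a b : R) :
  (forall x, x \notin `[a, b]%R -> u x = 0) ->
  compact (closure [set x | u x != 0]).
Proof.
move=> u0; apply: (@subclosed_compact _ _ [set` `[a, b]%R]).
- exact: closed_closure.
- exact: segment_compact.
- rewrite [X in _ `<=` X](closure_id _).1; last exact: interval_closed.
  apply: closureS.
  by move=> x /=; apply: contraNT => /u0 ->.
Qed.

Lemma test_function_supported (u : R -> R) (a b : R) : smooth u ->
  (forall x, x \notin `[a, b]%R -> u x = 0) -> test_function u.
Proof. by move=> su u0; split=> //; exact: supported_compact u0. Qed.

(** Test functions along one basis vector reduce the vector equation to scalar ones. *)
Lemma derive1_delta n (u : R -> R) (i : 'I_n) : smooth u ->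
  forall x : R, derive1 (fun x => u x *: (delta_mx 0 i : 'rV[R]_n)) x =
                derive1 u x *: delta_mx 0 i.
Proof.
move=> su x; rewrite derive1E derive_mx.
  apply/rowP => j; rewrite !mxE derive1E.
  under eq_fun do rewrite !mxE/=.
  have [_] := is_deriveM (is_derive_smooth x su)
    (is_derive_cst ((j == i)%:R : R) x 1).
  by rewrite scaler0 add0r derive1E => ->; rewrite /GRing.scale/= mulrC.
apply/derivable_mxP => k j; under eq_fun do rewrite !mxE/=.
apply: (@derivableM _ _ u (cst _)); first exact: (su 0%N).
exact: derivable_cst.
Qed.

Lemma test_function_delta n (u : R -> R) (a b : R) (i : 'I_n) : smooth u ->
  (forall x, x \notin `[a, b]%R -> u x = 0) ->
  test_function (fun x => u x *: (delta_mx 0 i : 'rV[R]_n)).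
Proof.
move=> su u0; split; last first.
  by apply: (@supported_compact _ _ a b) => x /u0 ->; rewrite scale0r.
apply: smooth_mx => j; under eq_fun do rewrite !mxE.
apply: smooth_alg_smooth; apply: smooth_alg_mul; last exact: smooth_alg_cst.
exact: smooth_alg_gen.
Qed.

End test_functions_and_primitives.

(** * The weak equation read coordinate by coordinate *)

Section weak_solution_regularity.
Context {R : realType}.
Notation mu := (@lebesgue_measure R).

Lemma continuous_coord n (f : R -> 'rV[R]_n) i : continuous f ->
  continuous (fun x => f x 0 i).
Proof.
by move=> cf x; apply: (@continuous_comp _ _ _ f (fun M : 'rV[R]_n => M 0 i));
  [exact: cf|exact: coord_continuous].
Qed.

Lemma locally_integrable_crossp (f v : R -> 'rV[R]_3) :
  continuous f -> L1loc v -> L1loc (fun x => crossp (f x) (v x)).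
Proof.
move=> cf lv.
have L i j k l : locally_integrable setT (fun x => f x 0 i * v x 0 j - f x 0 k * v x 0 l).
  by apply: locally_integrableB; apply: locally_integrableM => //;
    exact: continuous_coord.
by apply: ord3P; under eq_fun do rewrite crossp3; exact: L.
Qed.

Lemma locally_integrable_dotp (v : R -> 'rV[R]_3) : L2loc v ->
  locally_integrable setT (fun x => dotp (v x) (v x)).
Proof.
move=> lv; under eq_fun do rewrite dotp3 -!expr2.
by apply: locally_integrableD; [apply: locally_integrableD|]; apply: (lv _).2.
Qed.

(* The weak form of the equation says that [forcing] is the weak derivative of
   [flux]. *)
Definition flux al be (f df : R -> 'rV[R]_3) x :=
  al *: df x + be *: crossp (f x) (df x).

Definition forcing al (f df : R -> 'rV[R]_3) (x : R) :=
  (x / 2) *: df x - (al * dotp (df x) (df x)) *: f x.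

Section fixed_derivative.
Variables (al be : R) (f df : R -> 'rV[R]_3).
Hypothesis f_continuous : continuous f.
Hypothesis df_L1 : L1loc df.
Hypothesis df_L2 : L2loc df.

Lemma flux_L1loc : L1loc (flux al be f df).
Proof.
move=> i; under eq_fun do rewrite /flux mxE [X in X + _]mxE [X in _ + X]mxE.
apply: locally_integrableD; apply: locally_integrableZ; first exact: df_L1.
exact: (locally_integrable_crossp f_continuous df_L1 i).
Qed.

Lemma forcing_L1loc : L1loc (forcing al f df).
Proof.
move=> i; under eq_fun do rewrite /forcing !mxE.
apply: locally_integrableB.
  apply: locally_integrableM; last exact: df_L1.
  by move=> x; apply: cvgMl; exact: cvg_id.
rewrite (_ : (fun x => _) = fun x => al * f x 0 i * dotp (df x) (df x)).
  apply: locally_integrableM; last exact: locally_integrable_dotp.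
  by move=> x; apply: cvgMr; exact: continuous_coord.
by apply/funext => x; rewrite mulrAC.
Qed.

Lemma weak_solution_coord i phi (a b : R) :
  weak_solution al be f -> weak_derivative f df ->
  smooth phi -> (forall x, x \notin `[a, b]%R -> phi x = 0) ->
  \int[mu]_x (flux al be f df x 0 i * derive1 phi x) =
  - \int[mu]_x (forcing al f df x 0 i * phi x).
Proof.
move=> [_ _ _ wf] wdf sphi phi0.
have := wf df wdf _ (test_function_delta i sphi phi0).
pose P x := flux al be f df x 0 i * derive1 phi x.
pose Q x := forcing al f df x 0 i * phi x.
(* For the test function [phi] times the basis vector [i], the terms with phi' add up to [- P] and
   those with phi to [- Q]. *)
rewrite (_ : (fun x => _) = fun x => - 1 * (P x + Q x)); last first.
  apply/funext => x; rewrite (derive1_delta i sphi) !dotp_delta enorm_sqr.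
  by rewrite /P /Q /flux /forcing !mxE; ring.
have iP : mu.-integrable setT (EFin \o P).
  apply: (@integrable_supported _ _ _ a b); last exact: flux_L1loc.
    exact/smooth_continuous/smooth_derive1.
  exact: derive1_supported phi0.
have iQ : mu.-integrable setT (EFin \o Q).
  apply: (@integrable_supported _ _ _ a b); last exact: forcing_L1loc.
    exact: smooth_continuous.
  exact: phi0.
rewrite RintegralZl//; last exact: (integrableD measurableT iP iQ).
rewrite RintegralD// mulN1r => /eqP; rewrite oppr_eq0 addr_eq0.
by move/eqP.
Qed.

End fixed_derivative.

End weak_solution_regularity.

(** * The polynomial system satisfied by [f] and [w] *)

Section first_order_system.
Context {R : realType}.
Notation mu := (@lebesgue_measure R).
Variables (al be : R).
Hypothesis al_neq0 : al != 0.
Hypothesis albe : al ^+ 2 + be ^+ 2 = 1.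

Let vel (f w : R -> 'rV[R]_3) (x : R) := velocity al be (f x) (w x).

(** The identity is a generator because [forcing] depends explicitly on x. *)
Definition coords (f w : R -> 'rV[R]_3) : set (R -> R) :=
  [set u | u = id \/
    exists i, u = (fun x => f x 0 i) \/ u = (fun x => w x 0 i)].

Lemma smooth_alg_velocity f w i :
  smooth_alg (coords f w) (fun x => vel f w x 0 i).
Proof.
have fA j : smooth_alg (coords f w) (fun x => f x 0 j).
  by apply: smooth_alg_gen; right; exists j; left.
have wA j : smooth_alg (coords f w) (fun x => w x 0 j).
  by apply: smooth_alg_gen; right; exists j; right.
have cA j k l m : smooth_alg (coords f w)
    (fun x => f x 0 j * w x 0 k - f x 0 l * w x 0 m).
  under eq_fun do rewrite -mulN1r.
  apply: smooth_alg_add; first exact: smooth_alg_mul.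
  by apply: smooth_alg_mul; [exact: smooth_alg_cst|exact: smooth_alg_mul].
(* The algebra has no subtraction, so differences are rewritten with a factor -1. *)
under eq_fun do rewrite /vel /velocity 2!mxE [X in X + _ + _]mxE
  [X in _ + X + _]mxE [X in _ - X + _]mxE [X in _ + X]mxE -mulN1r dotp3.
apply: smooth_alg_add; last first.
  apply: smooth_alg_mul => //; apply: smooth_alg_mul.
    exact: smooth_alg_cst.
  by apply: smooth_alg_add; [apply: smooth_alg_add|]; exact: smooth_alg_mul.
apply: smooth_alg_add.
  by apply: smooth_alg_mul => //; exact: smooth_alg_cst.
apply: smooth_alg_mul; first exact: smooth_alg_cst.
apply: smooth_alg_mul; first exact: smooth_alg_cst.
by move: i; apply: ord3P; under eq_fun do rewrite crossp3.
Qed.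

Lemma smooth_alg_forcing f w i :
  smooth_alg (coords f w) (fun x => forcing al f (vel f w) x 0 i).
Proof.
have fA j : smooth_alg (coords f w) (fun x => f x 0 j).
  by apply: smooth_alg_gen; right; exists j; left.
have vA := smooth_alg_velocity f w.
under eq_fun do rewrite /forcing mxE [X in X + _]mxE [X in _ + X]mxE
  [X in _ - X]mxE -mulN1r dotp3.
apply: smooth_alg_add.
  apply: smooth_alg_mul => //; apply: smooth_alg_mul.
    by apply: smooth_alg_gen; left.
  exact: smooth_alg_cst.
apply: smooth_alg_mul; first exact: smooth_alg_cst.
apply: smooth_alg_mul => //; apply: smooth_alg_mul; first exact: smooth_alg_cst.
by apply: smooth_alg_add; [apply: smooth_alg_add|]; exact: smooth_alg_mul.
Qed.

(** The vector [w] is the continuous representative of the flux. Inverting the flux almost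
    everywhere expresses [df] through [f] and [w], so [f] and [w] are primitives of functions that
    agree almost everywhere with continuous ones. *)
Lemma weak_solution_system (f : R -> 'rV[R]_3) : weak_solution al be f ->
  exists w : R -> 'rV[R]_3, forall i (x : R),
    is_derive x 1 (fun y => f y 0 i) (vel f w x 0 i) /\
    is_derive x 1 (fun y => w y 0 i) (forcing al f (vel f w) x 0 i).
Proof.
move=> fs; have [cf f1 [fL2 [df [wdf df2]]] _] := fs.
have df1 : L1loc df by case: wdf.
have f_L1 i : locally_integrable setT (fun x => f x 0 i).
  rewrite (_ : (fun x => _) = fun x => f x 0 i * 1).
    apply: locally_integrableM; first exact: continuous_coord.
    exact: locally_integrable_cst.
  by apply/funext => x; rewrite mulr1.
have /choice[w wP] : forall i, exists w, [/\ continuous w,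
    {ae mu, forall x, flux al be f df x 0 i = w x} &
    forall a b, a <= b ->
      w b - w a = \int[mu]_(x in `[a, b]) forcing al f df x 0 i].
  move=> i; apply: du_bois_reymond.
  - exact: (flux_L1loc al be cf df1 i).
  - exact: (forcing_L1loc al cf df1 df2 i).
  - move=> phi c d sphi phi0.
    exact: (weak_solution_coord cf df1 df2 i fs wdf sphi phi0).
(* The continuous primitive [v] agrees with [f] almost everywhere, hence everywhere, since [f] is
   continuous as well. *)
have fB i a b : a <= b -> f b 0 i - f a 0 i = \int[mu]_(x in `[a, b]) df x 0 i.
  have [|v [cv fv vB]] := @du_bois_reymond _ (fun x => f x 0 i)
    (fun x => df x 0 i) (f_L1 i) (df1 i).
    move=> phi c d sphi phi0; case: wdf => _; apply.
    exact: test_function_supported phi0.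
  move=> ab; rewrite -vB//.
  by rewrite -(continuous_ae_eq (continuous_coord (i := i) cf) cv fv).
pose W x := \row_i w i x.
have WE i : (fun x => W x 0 i) = w i by apply/funext => x; rewrite mxE.
have cW i : continuous (fun x => W x 0 i) by rewrite WE; case: (wP i).
have cS u : coords f W u -> continuous u.
  move=> [->|[i [->|->]]]; first by move=> x; exact: cvg_id.
    exact: continuous_coord.
  exact: cW.
have dfE : {ae mu, forall x, df x = vel f W x}.
  have fluxE i : {ae mu, forall x, flux al be f df x 0 i = W x 0 i}.
    have [_ + _] := wP i; apply: filter_app.
      exact: (ae_filter_ringOfSetsType mu).
    by apply: aeW => x ->; rewrite mxE.
  move: (fluxE (inord 0)) (fluxE (inord 1)) (fluxE (inord 2)) => + + h2.
  apply: filter_app2; first exact: (ae_filter_ringOfSetsType mu).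
  move: h2.
  apply: filter_app; first exact: (ae_filter_ringOfSetsType mu).
  apply: aeW => x h2 h0 h1.
  rewrite /vel -(_ : flux al be f df x = W x).
    by rewrite /flux velocityK// sphere2_dotp.
  by apply/rowP; exact: ord3P.
exists W => i x; split.
  apply: (is_derive_primitive (k := fun y => vel f W y 0 i) (fB i)).
  - by case: (df1 i).
  - exact: smooth_alg_continuous cS _ (smooth_alg_velocity f W i).
  - move: dfE; apply: filter_app; first exact: (ae_filter_ringOfSetsType mu).
    by apply: aeW => y ->.
rewrite WE; have [_ _ wB] := wP i; apply: (is_derive_primitive
  (k := fun y => forcing al f (vel f W) y 0 i) wB).
- by case: (forcing_L1loc al cf df1 df2 i).
- exact: smooth_alg_continuous cS _ (smooth_alg_forcing f W i).
- move: dfE; apply: filter_app; first exact: (ae_filter_ringOfSetsType mu).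
  by apply: aeW => y dfy; rewrite /forcing dfy.
Qed.

End first_order_system.

(** The system places the derivatives of the coordinates of [f] and [w] in the algebra that they
    generate with x, so [smooth_algP] gives all orders at once. *)
Lemma smooth_first_order_system (R : realType) (al be : R)
    (f w : R -> 'rV[R]_3) :
  (forall i (x : R),
    is_derive x 1 (fun y => f y 0 i) (velocity al be (f x) (w x) 0 i) /\
    is_derive x 1 (fun y => w y 0 i)
      (forcing al f (fun y => velocity al be (f y) (w y)) x 0 i)) ->
  smooth f.
Proof.
move=> fw; apply: smooth_mx => i; apply: (@smooth_algP _ (coords f w)); last first.
  by apply: smooth_alg_gen; right; exists i; left.
move=> _ [->|[j [->|->]]].
- by exists (fun=> 1); [exact: smooth_alg_cst|move=> x; exact: is_derive_id].
- exists (fun x => velocity al be (f x) (w x) 0 j).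
    exact: smooth_alg_velocity.
  by move=> x; have [] := fw j x.
- exists (fun x => forcing al f (fun y => velocity al be (f y) (w y)) x 0 j).
    exact: smooth_alg_forcing.
  by move=> x; have [] := fw j x.
Qed.

Lemma is_derive_dotp (R : realType) (u v du dv : R -> 'rV[R]_3) (x : R) :
  (forall i, is_derive x 1 (fun y => u y 0 i) (du x 0 i)) ->
  (forall i, is_derive x 1 (fun y => v y 0 i) (dv x 0 i)) ->
  is_derive x 1 (fun y => dotp (u y) (v y)) (dotp (du x) (v x) + dotp (u x) (dv x)).
Proof.
move=> hu hv.
pose p i y := u y 0 i * v y 0 i.
have hp i : is_derive x 1 (p i) (du x 0 i * v x 0 i + u x 0 i * dv x 0 i).
  apply: (is_derive_eq (is_deriveM (hu i) (hv i))).
  by rewrite /GRing.scale/= addrC [v x 0 i * _]mulrC.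
rewrite (_ : (fun y => _) = p (inord 0) + p (inord 1) + p (inord 2)).
  apply: is_derive_eq; rewrite !dotp3; ring.
by apply/funext => y; rewrite dotp3.
Qed.

(** * Smoothness of the solution and growth of |f'| *)

Unset Implicit Arguments.

Theorem theorem1p1 (R : realType) (alpha beta : R)
  (alpha_gt0 : 0 < alpha) (alpha_le1 : alpha <= 1)
  (betaE : beta = Num.sqrt (1 - alpha ^+ 2))
  (f : R -> 'rV[R]_3) (f_sol : weak_solution alpha beta f) :
  (smooth f /\ (forall x : R, sphere2 (f x))) /\
  exists c : R, 0 <= c /\
    forall x : R, enorm (derive1 f x) = c * expR (alpha * x ^+ 2 / 4).
Proof.
have albe : alpha ^+ 2 + beta ^+ 2 = 1.
  rewrite betaE sqr_sqrtr; first by rewrite addrC subrK.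
  by rewrite subr_ge0 expr_le1// ltW.
have al0 : alpha != 0 by rewrite gt_eqF.
have f1 : forall x, sphere2 (f x) by case: f_sol.
have f11 x : dotp (f x) (f x) = 1 by exact: sphere2_dotp.
have [w fw] := weak_solution_system al0 albe f_sol.
have sf := smooth_first_order_system fw.
split=> //.
pose g x := velocity alpha beta (f x) (w x).
pose k := forcing alpha f g.
have df i (x : R) : is_derive x 1 (fun y => f y 0 i) (g x 0 i).
  exact: (fw i x).1.
have dw i (x : R) : is_derive x 1 (fun y => w y 0 i) (k x 0 i).
  exact: (fw i x).2.
have f'E x : derive1 f x = g x.
  rewrite derive1E derive_mx; last exact: (sf 0%N).
  by apply/rowP => i; rewrite mxE; have [] := df i x.
(* Differentiating |f|^2 = 1 gives 2 f . f' = 0. *)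
have fg x : dotp (f x) (g x) = 0.
  have := is_derive_dotp (df ^~ x) (df ^~ x).
  rewrite (_ : (fun y => _) = cst 1); last exact/funext.
  have -> : dotp (g x) (f x) = dotp (f x) (g x) by rewrite !dotp3; ring.
  by move=> [_]; rewrite derive_cst => h; lra.
have fw0 x : dotp (f x) (w x) = 0.
  have := fg x; rewrite /g dotp_velocity// => /eqP.
  by rewrite mulf_eq0 invr_eq0 (negPf al0) orbF => /eqP.
pose y x := dotp (w x) (w x).
have yE x : enorm (derive1 f x) = Num.sqrt (y x).
  by rewrite f'E /enorm (velocity_orthogonal albe (f11 x) (fw0 x)).2.
(* In w . w' the term of [forcing] along [f] drops out because f . w = 0, and w . f' = alpha |w|^2
   handles the other. *)
have dy (x : R) : is_derive x 1 y (alpha * x * y x).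
  apply: (is_derive_eq (is_derive_dotp (dw ^~ x) (dw ^~ x))).
  have wk : dotp (w x) (k x) = alpha * x / 2 * y x.
    have wg : dotp (w x) (g x) = alpha * y x.
      exact: (velocity_orthogonal albe (f11 x) (fw0 x)).1.
    have -> : dotp (w x) (k x) = x / 2 * dotp (w x) (g x) -
        alpha * dotp (g x) (g x) * dotp (f x) (w x).
      (* Generalizing [g x] keeps its coordinates as atoms of the polynomial identity. *)
      rewrite /k /forcing; move: (g x) => gx.
      by rewrite !dotp3 !mxE; ring.
    by rewrite wg fw0; ring.
  have -> : dotp (k x) (w x) = dotp (w x) (k x) by rewrite !dotp3; ring.
  by rewrite wk; field.
(* The integrating factor of y' = alpha x y makes [z] constant. *)
pose z x := y x * expR (- (alpha * x ^+ 2 / 2)).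
have dz (x : R) : is_derive x 1 z 0.
  have dq : is_derive x 1 (fun t : R => - (alpha * t ^+ 2 / 2)) (- (alpha * x)).
    rewrite (_ : (fun t => _) = (- (alpha / 2)) *: (id : R -> R) ^+ 2).
      apply: is_derive_eq; rewrite /GRing.scale/= expr1 mulr1.
      by rewrite mulNr mulrA divfK// pnatr_eq0.
    apply/funext => t; transitivity (- (alpha / 2) * t ^+ 2) => //.
    by rewrite mulNr mulrAC.
  have de := @realfun.is_derive1_comp _ expR
    (fun t : R => - (alpha * t ^+ 2 / 2)) x _ _ (is_derive_expR _) dq.
  apply: (is_derive_eq (is_deriveM (dy x) de)).
  by rewrite /GRing.scale/=; ring.
have zE x : y x = y 0 * expR (alpha * x ^+ 2 / 2).
  have := is_derive_0_is_cst x 0 dz.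
  rewrite /z expr0n mulr0 mul0r oppr0 expR0 mulr1 => <-.
  by rewrite -mulrA -expRD addNr expR0 mulr1.
(* The constant is |w(0)| = |f'(0)|; the square root halves the exponent alpha x^2 / 2. *)
exists (Num.sqrt (y 0)); split=> [|x]; first exact: sqrtr_ge0.
rewrite yE zE sqrtrM ?dotp_ge0//; congr (_ * _).
rewrite (_ : alpha * x ^+ 2 / 2 = alpha * x ^+ 2 / 4 + alpha * x ^+ 2 / 4); last by field.
by rewrite expRD -expr2 sqrtr_sqr ger0_norm// expR_ge0.
Qed.
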